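(* Let $D \subset \mathbb{R}$ be an open interval, let $f : D \to \mathbb{R}$ have first, second and third derivatives in $D$, and let $\alpha \in D$ be a simple root of $f$, i.e. $f(\alpha)=0$ and $f'(\alpha)\neq 0$. Let $M = 2^{J_1}$ with $J_1\ge 0$ an integer. If the initial guess $x_0$ is sufficiently close to $\alpha$, then the iterative method $$x_{n+1}=x_n-\frac{2M\, f(x_n)}{\sum_{k=1}^{2M} f'\!\left(x_n-\frac{f(x_n)}{f'(x_n)}\cdot\frac{k-0.5}{2M}\right)},\qquad n=0,1,2,\dots$$ converges cubically to $\alpha$. That is, there exist $\delta>0$ and $K\ge 0$ such that for every $x_0\in D$ with $|x_0-\alpha|<\delta$ the sequence $(x_n)_{n\ge 0}$ is well defined (all points at which $f$ and $f'$ are evaluated lie in $D$ and all denominators are nonzero), $x_n\to\alpha$ as $n\to\infty$, and $|x_{n+1}-\alpha|\le K\,|x_n-\alpha|^3$ for all $n\ge 0$.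
   Context: The integer $M=2^{J_1}$ is a fixed parameter of the method, where $J_1$ is the maximum level of resolution of the Haar wavelets from which the method is derived. ''Converges cubically'' means convergence of order (at least) three, i.e. the error $e_n = x_n-\alpha$ satisfies $e_{n+1}=O(e_n^3)$. *)

(* Defs.v *)
(* Real analysis over the Stdlib reals R, with Coquelicot's derivatives and limits. *)
From Stdlib Require Import Reals.
From Coquelicot Require Import Coquelicot.
Open Scope R_scope.

(* The endpoints range over Rbar, so that half-lines and R itself are included. *)
Definition Rbar_open_interval (a b : Rbar) (x : R) : Prop :=
  Rbar_lt a x /\ Rbar_lt x b.

(* A function f : D -> R is represented by a total function, with irrelevant
   values outside the open set D.  Since Coquelicot's [Derive] is total,
   [ex_derive_n f 3 x] alone does not give the lower-order derivatives,
   hence the quantification over k. *)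
Definition thrice_derivable_on (D : R -> Prop) (f : R -> R) : Prop :=
  forall x : R, D x -> forall k : nat, (k <= 3)%nat -> ex_derive_n f k x.

Definition haar_node (M : nat) (f : R -> R) (x : R) (k : nat) : R :=
  x - f x / Derive f x * ((INR k - 1 / 2) / (2 * INR M)).

Definition haar_denom (M : nat) (f : R -> R) (x : R) : R :=
  sum_n_m (fun k : nat => Derive f (haar_node M f x k)) 1 (2 * M).

Definition haar_step (M : nat) (f : R -> R) (x : R) : R :=
  x - 2 * INR M * f x / haar_denom M f x.

Fixpoint haar_iter (M : nat) (f : R -> R) (x0 : R) (n : nat) : R :=
  match n with
  | O => x0
  | S m => haar_step M f (haar_iter M f x0 m)
  end.

(* Division is total in R: this says that the step from x involves no division
   by zero and evaluates f and its derivative only at points of D. *)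
Definition haar_step_well_defined
    (D : R -> Prop) (M : nat) (f : R -> R) (x : R) : Prop :=
  D x /\ Derive f x <> 0 /\
  (forall k : nat, (1 <= k <= 2 * M)%nat -> D (haar_node M f x k)) /\
  haar_denom M f x <> 0.

(* Main.v *)
(** Write e = x - alpha, c1 = f'(alpha), c2 = f''(alpha) and u = f(x) / f'(x).
    Differentiability of f'' at alpha alone gives f'(alpha + t) = c1 + c2 t + O(t^2)
    and f(alpha + t) = c1 t + c2 t^2 / 2 + O(t^3).  The weights (k - 1/2) / (2M) have
    mean 1/2 and u = e + O(e^2), so the mean A of the values of f' at the nodes is
    c1 + c2 e / 2 + O(e^2).  The new error e - f(x) / A = (e A - f(x)) / A is
    therefore O(e^3). *)
Require Import Defs.
From Stdlib Require Import Reals Lra Lia.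
From Coquelicot Require Import Coquelicot.
Open Scope R_scope.

(** * Local Taylor bounds *)

(** Near [c] the difference quotient is within 1 of the derivative [l], whence [L = |l| + 1].
    Applied to f'', this controls f'' around the root even where f''' is discontinuous. *)
Lemma ex_derive_locally_lipschitz (h : R -> R) (c : R) :
  ex_derive h c ->
  exists eta L : R, 0 < eta /\ 0 <= L /\
    forall y, Rabs (y - c) < eta -> Rabs (h y - h c) <= L * Rabs (y - c).
Proof.
intros [l Hl].
apply is_derive_Reals in Hl.
destruct (Hl 1 Rlt_0_1) as [eta Heta].
exists eta, (Rabs l + 1).
split; [apply cond_pos|]. split; [pose proof (Rabs_pos l); lra|].
intros y Hy.
destruct (Req_dec (y - c) 0) as [E|E].
- replace y with c by lra. rewrite !Rminus_diag, !Rabs_R0. lra.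
- specialize (Heta (y - c) E Hy).
  replace (c + (y - c)) with y in Heta by ring.
  replace (h y - h c) with ((h y - h c) / (y - c) * (y - c)) by (field; exact E).
  rewrite Rabs_mult.
  apply Rmult_le_compat_r; [apply Rabs_pos|].
  pose proof (Rabs_triang ((h y - h c) / (y - c) - l) l) as T.
  replace ((h y - h c) / (y - c) - l + l) with ((h y - h c) / (y - c)) in T by ring.
  lra.
Qed.

(** By the mean value theorem [phi y = dphi z * (y - c)] with [z] between [c] and [y], so [z] is no
    farther from [c] than [y]. This stands in for integration: the factor 1/(n+1) is given up, and
    the same [L] serves at every order. *)
Lemma is_derive_pow_bound (phi dphi : R -> R) (c eta L : R) (n : nat) :
  0 <= L -> phi c = 0 ->
  (forall y, Rabs (y - c) < eta -> is_derive phi y (dphi y)) ->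
  (forall y, Rabs (y - c) < eta -> Rabs (dphi y) <= L * Rabs (y - c) ^ n) ->
  forall y, Rabs (y - c) < eta -> Rabs (phi y) <= L * Rabs (y - c) ^ S n.
Proof.
intros HL H0 Hd Hb y Hy.
assert (Hin : forall z, Rmin c y <= z <= Rmax c y -> Rabs (z - c) <= Rabs (y - c)).
{ intros z. unfold Rmin, Rmax, Rabs.
  destruct (Rle_dec c y), (Rcase_abs (z - c)), (Rcase_abs (y - c)); lra. }
destruct (MVT_gen phi c y dphi) as [z [Hz E]].
- intros z Hz. apply Hd. apply Rle_lt_trans with (2 := Hy). apply Hin. lra.
- intros z Hz. apply continuity_pt_filterlim.
  apply (ex_derive_continuous phi z). exists (dphi z). apply Hd.
  apply Rle_lt_trans with (2 := Hy). now apply Hin.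
- rewrite H0, Rminus_0_r in E. rewrite E, Rabs_mult.
  simpl pow. rewrite (Rmult_comm (Rabs (y - c))), <- Rmult_assoc.
  apply Rmult_le_compat_r; [apply Rabs_pos|].
  specialize (Hin z Hz).
  apply Rle_trans with (1 := Hb z (Rle_lt_trans _ _ _ Hin Hy)).
  apply Rmult_le_compat_l; [exact HL|].
  apply pow_incr. split; [apply Rabs_pos|exact Hin].
Qed.

(** The Lipschitz bound for f'' at [c] is raised by [is_derive_pow_bound] first to f' and then to
    f. *)
Lemma thrice_derivable_taylor (D : R -> Prop) (f : R -> R) (c : R) :
  thrice_derivable_on D f -> locally c D ->
  exists eta L : R, 0 < eta /\ 0 <= L /\
    (forall y, Rabs (y - c) < eta -> D y) /\
    (forall y, Rabs (y - c) < eta ->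
       Rabs (Derive f y - Derive f c - Derive_n f 2 c * (y - c))
         <= L * Rabs (y - c) ^ 2) /\
    (forall y, Rabs (y - c) < eta ->
       Rabs (f y - f c - Derive f c * (y - c) - Derive_n f 2 c / 2 * (y - c) ^ 2)
         <= L * Rabs (y - c) ^ 3).
Proof.
intros Hf HD.
pose proof (locally_singleton _ _ HD) as Dc.
destruct HD as [e0 He0].
destruct (ex_derive_locally_lipschitz (Derive_n f 2) c (Hf c Dc 3%nat (le_n _)))
  as (e1 & L & He1 & HL & Hlip).
assert (Hm : forall y, Rabs (y - c) < Rmin e0 e1 -> D y /\ Rabs (y - c) < e1).
{ intros y Hy. split.
  - apply He0. apply Rlt_le_trans with (1 := Hy). apply Rmin_l.
  - apply Rlt_le_trans with (1 := Hy). apply Rmin_r. }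
exists (Rmin e0 e1), L.
split; [apply Rmin_glb_lt; [apply cond_pos|exact He1]|].
split; [exact HL|].
split; [intros y Hy; now apply Hm|].
assert (H1 : forall y, Rabs (y - c) < Rmin e0 e1 ->
       Rabs (Derive f y - Derive f c - Derive_n f 2 c * (y - c))
         <= L * Rabs (y - c) ^ 2).
{ apply (is_derive_pow_bound
    (fun y => Derive f y - Derive f c - Derive_n f 2 c * (y - c))
    (fun y => Derive_n f 2 y - Derive_n f 2 c) c (Rmin e0 e1) L 1 HL).
  - ring.
  - intros y Hy. destruct (Hm y Hy) as [Dy _].
    pose proof (Hf y Dy 2%nat ltac:(lia)) as Hy2.
    change (ex_derive (Derive f) y) in Hy2.
    change (Derive_n f 2 y) with (Derive (Derive f) y).
    generalize (Derive_n f 2 c) as c2; intros c2.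
    apply (is_derive_ext (fun t => minus (Derive f t) (Derive f c + c2 * (t - c)))).
    { intros t. unfold minus, plus, opp; simpl. ring. }
    apply (is_derive_minus (Derive f) (fun t => Derive f c + c2 * (t - c)) y).
    + now apply Derive_correct.
    + auto_derive; [trivial|ring].
  - intros y Hy. rewrite pow_1. apply Hlip. now apply Hm. }
split; [exact H1|].
apply (is_derive_pow_bound
    (fun y => f y - f c - Derive f c * (y - c) - Derive_n f 2 c / 2 * (y - c) ^ 2)
    (fun y => Derive f y - Derive f c - Derive_n f 2 c * (y - c))
    c (Rmin e0 e1) L 2 HL); [ring| |exact H1].
intros y Hy. destruct (Hm y Hy) as [Dy _].
pose proof (Hf y Dy 1%nat ltac:(lia)) as Hy1.
change (ex_derive f y) in Hy1.
generalize (Derive_n f 2 c) as c2; intros c2.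
generalize (Derive f c) as c1; intros c1.
apply (is_derive_ext
  (fun t => minus (f t) (f c + c1 * (t - c) + c2 / 2 * (t - c) ^ 2))).
{ intros t. unfold minus, plus, opp; simpl. ring. }
replace (Derive f y - c1 - c2 * (y - c))
  with (minus (Derive f y) (c1 + c2 * (y - c)))
  by (unfold minus, plus, opp; simpl; ring).
apply (is_derive_minus f (fun t => f c + c1 * (t - c) + c2 / 2 * (t - c) ^ 2) y).
- now apply Derive_correct.
- auto_derive; [trivial|field].
Qed.

(** * Averaging over the midpoint nodes *)

(** The numbers k - 1/2 for k = 1, ..., n sum to n^2/2, and the n errors add up. The spacing [s] is
    kept independent of [n], so that the induction can vary [n] alone. *)
Lemma sum_midpoint_affine_error (g : R -> R) (p q s B : R) (n : nat) :
  (forall k, (1 <= k <= n)%nat -> Rabs (g (INR k) - (p + q * (INR k - 1 / 2) * s)) <= B) ->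
  Rabs (sum_n_m (fun k => g (INR k)) 1 n - (INR n * p + q * s * (INR n ^ 2 / 2)))
    <= INR n * B.
Proof.
induction n as [|n IH]; intros H.
- rewrite sum_n_m_zero by lia. unfold zero; simpl.
  match goal with |- Rabs ?t <= _ => replace t with 0 by field end.
  rewrite Rabs_R0. lra.
- rewrite sum_n_Sm by lia.
  specialize (IH (fun k Hk => H k ltac:(lia))).
  specialize (H (S n) ltac:(lia)).
  change (@plus R_AbelianMonoid) with Rplus.
  rewrite S_INR in H |- *.
  match type of IH with Rabs ?u <= _ => match type of H with Rabs ?v <= _ =>
    pose proof (Rabs_triang u v) as T;
    match goal with |- Rabs ?w <= _ => replace w with (u + v) end end end.
  + lra.
  + field.
Qed.

(** The node weights have mean 1/2, so averaging an affine function over the nodes gives its value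
    at x - u/2, where u = f(x)/f'(x); the average of the errors is still at most [B]. *)
Lemma haar_denom_error (M : nat) (f : R -> R) (x c c1 c2 B : R) :
  (1 <= M)%nat ->
  (forall k, (1 <= k <= 2 * M)%nat ->
     Rabs (Derive f (haar_node M f x k) - c1 - c2 * (haar_node M f x k - c)) <= B) ->
  Rabs (haar_denom M f x / (2 * INR M) - c1 - c2 * (x - c - f x / Derive f x / 2)) <= B.
Proof.
intros HM H.
assert (HM0 : 0 < INR M) by (apply lt_0_INR; lia).
pose (g r := Derive f (x - f x / Derive f x * ((r - 1 / 2) / (2 * INR M)))).
pose proof (sum_midpoint_affine_error g (c1 + c2 * (x - c)) (- c2 * (f x / Derive f x))
  (/ (2 * INR M)) B (2 * M)) as S.
change (sum_n_m (fun k => g (INR k)) 1 (2 * M)) with (haar_denom M f x) in S.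
rewrite mult_INR in S. change (INR 2) with 2 in S.
assert (S' := S ltac:(clear S; intros k Hk; specialize (H k Hk);
  match goal with |- Rabs ?t <= _ => match type of H with Rabs ?w <= _ =>
    replace t with w; [exact H|] end end;
  unfold g, haar_node, Rdiv; ring)).
clear S.
apply Rmult_le_reg_l with (2 * INR M); [lra|].
apply Rle_trans with (2 := S').
rewrite <- (Rabs_pos_eq (2 * INR M)) at 1 by lra.
rewrite <- Rabs_mult. right. f_equal.
generalize (f x / Derive f x) as u; intros u. field. lra.
Qed.

(** * Error of a single step *)

Lemma haar_step_cubic (D : R -> Prop) (M : nat) (f : R -> R) (c : R) :
  (1 <= M)%nat -> thrice_derivable_on D f -> locally c D ->
  f c = 0 -> Derive f c <> 0 ->
  exists rho K : R, 0 < rho /\ 0 <= K /\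
    forall x, Rabs (x - c) < rho ->
      haar_step_well_defined D M f x /\
      Rabs (haar_step M f x - c) <= K * Rabs (x - c) ^ 3.
Proof.
intros HM Hf HD H0 H1.
destruct (thrice_derivable_taylor D f c Hf HD) as (eta & L & Heta & HL & HinD & Hg & Hfx).
revert Hg Hfx H1.
generalize (Derive_n f 2 c) as c2; generalize (Derive f c) as c1.
intros c1 c2 Hg Hfx H1. rewrite H0 in Hfx.
pose (p := Rabs c1). pose (q := Rabs c2). pose (Q := 2 * L + q).
assert (Hp : 0 < p) by now apply Rabs_pos_lt.
assert (Hq : 0 <= q) by apply Rabs_pos.
assert (HQ : 0 <= Q) by (unfold Q; lra).
assert (HM0 : 0 < INR M) by (apply lt_0_INR; lia).
(* The bound 1 lets higher powers of the error be absorbed into lower ones. The bound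
   [p / (2 * Q + 1)] yields [2 * Q * d <= p], and its [+ 1] covers [Q = 0]. In the second witness,
   [2 / p] comes from [|A| >= p / 2] and the other factor bounds the numerator [e * A - f x]. *)
exists (Rmin eta (Rmin 1 (p / (2 * Q + 1)))), ((2 * L + q * (Q / p)) * (2 / p)).
assert (HQp : 0 <= Q / p) by (apply Rdiv_le_0_compat; lra).
split.
{ repeat apply Rmin_glb_lt; try lra. apply Rdiv_lt_0_compat; lra. }
split.
{ apply Rmult_le_pos; [nra|]. apply Rdiv_le_0_compat; lra. }
intros x Hx.
assert (Hxe : Rabs (x - c) < eta) by (eapply Rlt_le_trans; [exact Hx|apply Rmin_l]).
assert (Hx1 : Rabs (x - c) < 1).
{ eapply Rlt_le_trans; [exact Hx|]. eapply Rle_trans; [apply Rmin_r|apply Rmin_l]. }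
assert (HxQ : 2 * Q * Rabs (x - c) <= p).
{ assert (Hx2 : Rabs (x - c) < p / (2 * Q + 1)).
  { eapply Rlt_le_trans; [exact Hx|]. eapply Rle_trans; [apply Rmin_r|apply Rmin_r]. }
  pose proof (Rabs_pos (x - c)).
  apply Rmult_lt_compat_r with (r := 2 * Q + 1) in Hx2; [|lra].
  replace (p / (2 * Q + 1) * (2 * Q + 1)) with p in Hx2 by (field; lra). nra. }
clear Hx.
pose (e := x - c). fold e in Hxe, Hx1, HxQ |- *.
pose (d := Rabs e). fold d in Hxe, Hx1, HxQ |- *.
assert (Hd : 0 <= d) by apply Rabs_pos.
assert (Hgx := Hg x Hxe). assert (Hfx' := Hfx x Hxe). clear Hfx.
fold e d in Hgx, Hfx'.
(* Such a [B] differs from [c1] by at most [Q * d <= p / 2]. This serves for both denominators: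
   f'(x) with [t = e], and the mean [A] with [t = e - u / 2]. *)
assert (Hlow : forall t B : R, Rabs t <= d -> Rabs (B - c1 - c2 * t) <= L * d ^ 2 ->
  p / 2 <= Rabs B).
{ intros t B Ht HB.
  assert (Rabs (c2 * t) <= q * d).
  { rewrite Rabs_mult. now apply Rmult_le_compat_l. }
  assert (Rabs (B - c1) <= L * d ^ 2 + q * d).
  { replace (B - c1) with ((B - c1 - c2 * t) + c2 * t) by ring.
    eapply Rle_trans; [apply Rabs_triang|lra]. }
  assert (p <= Rabs B + Rabs (B - c1)).
  { unfold p. replace c1 with (B - (B - c1)) at 1 by ring.
    unfold Rminus at 1. eapply Rle_trans; [apply Rabs_triang|]. rewrite Rabs_Ropp. lra. }
  assert (L * d ^ 2 + q * d <= Q * d).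
  { pose proof (Rmult_le_pos L d HL Hd). unfold Q. nra. }
  lra. }
assert (Hg0 : p / 2 <= Rabs (Derive f x)) by (apply (Hlow e); [unfold d; lra|exact Hgx]).
assert (Hgn : Derive f x <> 0) by (intros E; rewrite E, Rabs_R0 in Hg0; lra).
pose (u := f x / Derive f x).
assert (Hu : Rabs (e - u) <= 2 * (Q / p) * d ^ 2).
(* The terms [c1 * e] cancel, leaving [c2 * e ^ 2 / 2] and two remainders of size [L * d ^ 3], each
   at most [L * d ^ 2] since [d < 1]. *)
{ assert (Hn : Rabs (Derive f x * e - f x) <= Q * d ^ 2).
  { replace (Derive f x * e - f x) with
      ((Derive f x - c1 - c2 * e) * e
       + (- (f x - 0 - c1 * e - c2 / 2 * e ^ 2) + c2 * (e ^ 2 / 2))) by field.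
    eapply Rle_trans; [apply Rabs_triang|].
    eapply Rle_trans; [apply Rplus_le_compat_l, Rabs_triang|].
    rewrite Rabs_Ropp, !Rabs_mult. fold d q.
    replace (Rabs (e ^ 2 / 2)) with (d ^ 2 / 2)
      by (unfold d; rewrite pow2_abs, Rabs_pos_eq; nra).
    assert (Rabs (Derive f x - c1 - c2 * e) * d <= L * d ^ 2 * d)
      by now apply Rmult_le_compat_r.
    assert (L * d ^ 3 <= L * d ^ 2).
    { apply Rmult_le_compat_l; [exact HL|]. pose proof (pow2_ge_0 d). nra. }
    assert (0 <= q * d ^ 2) by nra.
    unfold Q. simpl in *. lra. }
  replace (e - u) with ((Derive f x * e - f x) / Derive f x)
    by (unfold u; field; exact Hgn).
  unfold Rdiv at 1. rewrite Rabs_mult, Rabs_inv.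
  replace (2 * (Q / p) * d ^ 2) with (Q * d ^ 2 * / (p / 2)) by (field; lra).
  apply Rmult_le_compat; [apply Rabs_pos| |exact Hn|].
  - left. apply Rinv_0_lt_compat. lra.
  - apply Rinv_le_contravar; lra. }
(* [e - u] is the error of the Newton point x - u. Since this point is no farther from [c] than [x],
   the nodes, which lie on the segment joining the two, stay within [d] of [c]. *)
assert (Hud : Rabs (e - u) <= d).
{ apply Rle_trans with (1 := Hu).
  assert (2 * (Q / p) * d <= 1).
  { replace (2 * (Q / p) * d) with (2 * Q * d / p) by (field; lra).
    apply Rle_div_l; lra. }
  simpl. nra. }
(* [e - u * s] is a convex combination of [e] and [e - u]. *)
assert (Hconv : forall s, 0 <= s <= 1 -> Rabs (e - u * s) <= d).
{ intros s Hs. replace (e - u * s) with ((1 - s) * e + s * (e - u)) by ring.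
  eapply Rle_trans; [apply Rabs_triang|].
  rewrite !Rabs_mult, (Rabs_pos_eq s), (Rabs_pos_eq (1 - s)) by lra. fold d. nra. }
assert (Hnode : forall k, (1 <= k <= 2 * M)%nat -> Rabs (haar_node M f x k - c) <= d).
{ intros k [Hk1 Hk2].
  unfold haar_node. fold u.
  match goal with |- Rabs (x - u * ?s - c) <= _ =>
    replace (x - u * s - c) with (e - u * s) by (unfold e; ring) end.
  apply Hconv.
  apply le_INR in Hk1, Hk2. rewrite mult_INR in Hk2. simpl in Hk1, Hk2.
  split; [apply Rdiv_le_0_compat; lra|apply Rle_div_l; lra]. }
assert (HA : Rabs (haar_denom M f x / (2 * INR M) - c1 - c2 * (e - u / 2)) <= L * d ^ 2).
{ apply haar_denom_error; [exact HM|].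
  intros k Hk. specialize (Hnode k Hk).
  eapply Rle_trans; [apply Hg; lra|].
  apply Rmult_le_compat_l; [exact HL|]. apply pow_incr. split; [apply Rabs_pos|exact Hnode]. }
pose (A := haar_denom M f x / (2 * INR M)). fold A in HA.
assert (HA0 : p / 2 <= Rabs A).
{ apply (Hlow (e - u / 2)); [|exact HA]. apply (Hconv (/ 2)). lra. }
assert (HAn : A <> 0) by (intros E; rewrite E, Rabs_R0 in HA0; lra).
assert (Hden : haar_denom M f x <> 0).
{ intros E. apply HAn. unfold A. rewrite E. field. lra. }
split.
{ split; [now apply HinD|]. split; [exact Hgn|]. split; [|exact Hden].
  intros k Hk. apply HinD. specialize (Hnode k Hk). lra. }
replace (haar_step M f x - c) with ((e * A - f x) * / A)
  by (unfold haar_step, e, A; field; split; lra).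
rewrite Rabs_mult, Rabs_inv.
assert (HN : Rabs (e * A - f x) <= (2 * L + q * (Q / p)) * d ^ 3).
(* This cancellation gives the third order: the [c1] terms vanish and the [c2] terms combine to
   [c2 * (e - u) * e / 2], which is cubic because [e - u] is quadratic by [Hu]. *)
{ replace (e * A - f x) with
    (e * (A - c1 - c2 * (e - u / 2))
     + (- (f x - 0 - c1 * e - c2 / 2 * e ^ 2) + c2 * ((e - u) * (e / 2)))) by field.
  eapply Rle_trans; [apply Rabs_triang|].
  eapply Rle_trans; [apply Rplus_le_compat_l, Rabs_triang|].
  rewrite Rabs_Ropp, !Rabs_mult. fold q.
  replace (Rabs (e / 2)) with (d / 2)
    by (unfold d, Rdiv; rewrite Rabs_mult, (Rabs_pos_eq (/ 2)); lra).
  fold d.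
  assert (d * Rabs (A - c1 - c2 * (e - u / 2)) <= d * (L * d ^ 2))
    by now apply Rmult_le_compat_l.
  assert (q * (Rabs (e - u) * (d / 2)) <= q * (2 * (Q / p) * d ^ 2 * (d / 2))).
  { apply Rmult_le_compat_l; [exact Hq|]. apply Rmult_le_compat_r; lra. }
  simpl in *. lra. }
replace ((2 * L + q * (Q / p)) * (2 / p) * d ^ 3)
  with ((2 * L + q * (Q / p)) * d ^ 3 * / (p / 2)) by (field; lra).
apply Rmult_le_compat; [apply Rabs_pos| |exact HN|].
- left. apply Rinv_0_lt_compat. lra.
- apply Rinv_le_contravar; lra.
Qed.

(** * Convergence of the iteration *)

Lemma halving_error_is_lim_seq (u : nat -> R) (c : R) :
  (forall n, Rabs (u (S n) - c) <= Rabs (u n - c) / 2) -> is_lim_seq u c.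
Proof.
intros H.
assert (Hn : forall n, Rabs (u n - c) <= Rabs (u 0%nat - c) * (1 / 2) ^ n).
{ induction n as [|n IH]; [simpl; lra|].
  specialize (H n). simpl. lra. }
apply is_lim_seq_ext with (fun n => (u n - c) + c); [intros n; ring|].
replace (Finite c) with (Finite (0 + c)) by (f_equal; ring).
apply is_lim_seq_plus'; [|apply is_lim_seq_const].
apply is_lim_seq_abs_0.
apply is_lim_seq_le_le with (fun _ => 0) (fun n => Rabs (u 0%nat - c) * (1 / 2) ^ n).
- intros n. split; [apply Rabs_pos|apply Hn].
- apply is_lim_seq_const.
- replace (Finite 0) with (Rbar_mult (Rabs (u 0%nat - c)) 0) by (simpl; f_equal; ring).
  apply is_lim_seq_scal_l. apply is_lim_seq_geom. rewrite Rabs_pos_eq; lra.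
Qed.

Lemma Rbar_open_interval_locally (a b : Rbar) (x : R) :
  Rbar_open_interval a b x -> locally x (Rbar_open_interval a b).
Proof.
intros [Ha Hb].
apply filter_and; [exact (open_Rbar_gt' x a Ha)|exact (open_Rbar_lt' x b Hb)].
Qed.

Theorem theorem3p1 (a b : Rbar) (f : R -> R) (alpha : R) (J1 M : nat)
    (f_derivable : thrice_derivable_on (Rbar_open_interval a b) f)
    (alpha_in_D : Rbar_open_interval a b alpha)
    (alpha_root : f alpha = 0)
    (alpha_simple : Derive f alpha <> 0)
    (M_def : M = (2 ^ J1)%nat) :
  exists delta K : R, 0 < delta /\ 0 <= K /\
    forall x0 : R, Rbar_open_interval a b x0 -> Rabs (x0 - alpha) < delta ->
      (forall n : nat,
         haar_step_well_defined (Rbar_open_interval a b) M f (haar_iter M f x0 n)) /\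
      is_lim_seq (haar_iter M f x0) alpha /\
      (forall n : nat,
         Rabs (haar_iter M f x0 (S n) - alpha)
           <= K * Rabs (haar_iter M f x0 n - alpha) ^ 3).
Proof.
assert (HM : (1 <= M)%nat).
{ rewrite M_def. pose proof (Nat.pow_nonzero 2 J1). lia. }
destruct (haar_step_cubic (Rbar_open_interval a b) M f alpha HM f_derivable
  (Rbar_open_interval_locally a b alpha alpha_in_D) alpha_root alpha_simple)
  as (rho & K & Hrho & HK & Hstep).
(* For [d < delta] the last bound gives [K * d <= 1 / 2], and [d < 1] then gives
   [K * d ^ 3 <= d / 2]: the cubic estimate also halves the error. The [+ 1] covers [K = 0]. *)
pose (delta := Rmin rho (Rmin 1 (/ (2 * K + 1)))).
assert (Hdelta : 0 < delta).
{ repeat apply Rmin_glb_lt; try lra. apply Rinv_0_lt_compat. lra. }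
assert (Hsmall : forall d, 0 <= d < delta -> d < rho /\ K * d ^ 3 <= d / 2).
{ intros d [Hd0 Hd].
  pose proof (Rmin_l rho (Rmin 1 (/ (2 * K + 1)))).
  pose proof (Rmin_r rho (Rmin 1 (/ (2 * K + 1)))).
  pose proof (Rmin_l 1 (/ (2 * K + 1))).
  pose proof (Rmin_r 1 (/ (2 * K + 1))).
  unfold delta in Hd.
  split; [lra|].
  assert (Hd2 : (2 * K + 1) * d <= 1).
  { replace 1 with ((2 * K + 1) * / (2 * K + 1)) at 2 by (field; lra).
    apply Rmult_le_compat_l; lra. }
  assert (HKd : K * d <= 1 / 2) by lra.
  assert (K * d * d ^ 2 <= 1 / 2 * d ^ 2) by (apply Rmult_le_compat_r; nra).
  simpl in *. nra. }
exists delta, K. split; [exact Hdelta|]. split; [exact HK|].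
intros x0 _ Hx0.
(* Halving keeps every iterate in the [delta]-ball, so the one-step estimate applies at each [n]. *)
assert (Hin : forall n, Rabs (haar_iter M f x0 n - alpha) < delta).
{ induction n as [|n IH]; [exact Hx0|].
  pose proof (Rabs_pos (haar_iter M f x0 n - alpha)) as P.
  destruct (Hsmall _ (conj P IH)) as [Hr Hh].
  destruct (Hstep _ Hr) as [_ Hc].
  change (haar_iter M f x0 (S n)) with (haar_step M f (haar_iter M f x0 n)). lra. }
assert (Hall : forall n,
  haar_step_well_defined (Rbar_open_interval a b) M f (haar_iter M f x0 n) /\
  Rabs (haar_iter M f x0 (S n) - alpha) <= K * Rabs (haar_iter M f x0 n - alpha) ^ 3).
{ intros n. apply Hstep. apply Hsmall. split; [apply Rabs_pos|apply Hin]. }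
split; [intros n; apply Hall|]. split; [|intros n; apply Hall].
apply halving_error_is_lim_seq. intros n.
eapply Rle_trans; [apply Hall|].
apply Hsmall. split; [apply Rabs_pos|apply Hin].
Qed.
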